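(* Let $(A,\mathfrak m)$ be a regular local ring of dimension $d\geq 1$. Then there exists a $2$-periodic minimal complex $\mathbb F$ of finitely generated free $A$-modules (i.e. $\mathbb F=\mathbb F[2]$) with finite length cohomology such that $\beta(\mathbb F)=2^d$, i.e. $\mathrm{rank}\,\mathbb F^i=2^d$ for all $i\in\mathbb Z$.
   Context: Complexes are co-chain complexes indexed by $\mathbb Z$, possibly unbounded in both directions. A complex $\mathbb F$ of finitely generated free modules with differential $\partial$ is minimal if $\partial(\mathbb F)\subseteq\mathfrak m\mathbb F$. $\mathbb F[2]$ is the shift with $\mathbb F[2]^i=\mathbb F^{i+2}$. Finite length cohomology means $H^i(\mathbb F)$ has finite length for all $i\in\mathbb Z$. *)

(* Defs.v *)
From HB Require Import structures.
From mathcomp Require Import all_boot all_order all_algebra.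
From mathcomp Require Import boolp.

Set Implicit Arguments.
Unset Strict Implicit.
Unset Printing Implicit Defensive.

Import GRing.Theory.
Local Open Scope ring_scope.
Local Open Scope quotient_scope.

(* Boolean predicates serve as subsets throughout; with [asbool] from boolp,
   every Prop-valued predicate is equivalent to a boolean one. *)

Definition strict_subset (T : Type) (S S' : {pred T}) : Prop :=
  {subset S <= S'} /\ exists2 x, x \in S' & x \notin S.

Section RegularLocalRing.
Variable A : comNzRingType.
Implicit Types (I J m : {pred A}) (n d : nat).

(* Unlike [idealr_closed], this allows the unit ideal. *)
Definition is_ideal I : Prop := submod_closed (I : {pred A^o}).

Definition generated_by n (g : 'I_n -> A) I : Prop :=
  forall x, x \in I <-> exists c : 'I_n -> A, x = \sum_i c i * g i.

Definition noetherian : Prop :=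
  forall I, is_ideal I -> exists n (g : 'I_n -> A), generated_by g I.

Definition maximal_ideal m : Prop :=
  idealr_closed m /\
  forall J, idealr_closed J -> {subset m <= J} -> J =i m.

Definition local_ring m : Prop :=
  maximal_ideal m /\ forall J, maximal_ideal J -> J =i m.

Definition prime_ideal I : Prop := idealr_closed I /\ prime_idealr_closed I.

(* P 0 < P 1 < ... < P n; the values of P beyond n are irrelevant. *)
Definition prime_chain n (P : nat -> {pred A}) : Prop :=
  (forall i, (i <= n)%N -> prime_ideal (P i)) /\
  (forall i, (i < n)%N -> strict_subset (P i) (P i.+1)).

Definition krull_dim d : Prop :=
  (exists P, prime_chain d P) /\
  (forall n P, prime_chain n P -> (n <= d)%N).

Definition min_number_of_generators I n : Prop :=
  (exists g : 'I_n -> A, generated_by g I) /\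
  (forall k (g : 'I_k -> A), generated_by g I -> (n <= k)%N).

Definition regular_local_ring m d : Prop :=
  [/\ noetherian, local_ring m, krull_dim d & min_number_of_generators m d].

End RegularLocalRing.

(* [S] renamed so that the proof [Sc] can be attached to it as instances. *)
Section SubmodulePredicate.
Variables (A : comNzRingType) (V : lmodType A).
Variables (S : {pred V}) (Sc : submod_closed S).

Definition submodule_pred of submod_closed S : {pred V} := S.

HB.instance Definition _ :=
  GRing.isSubmodClosed.Build A V (submodule_pred Sc)
    (GRing.submod_closed_semi Sc).

End SubmodulePredicate.

Section Submodule.
Variables (A : comNzRingType) (V : lmodType A).
Variables (S : {pred V}) (Sc : submod_closed S).

Record submodule : predArgType := Submodule {
  submodule_val : V;
  submodule_valP : submodule_val \in submodule_pred Sc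
}.

HB.instance Definition _ := [isSub of submodule for submodule_val].
HB.instance Definition _ := [Choice of submodule by <:].
HB.instance Definition _ := [SubChoice_isSubZmodule of submodule by <:].
HB.instance Definition _ := [SubZmodule_isSubLmodule of submodule by <:].

End Submodule.

(* The additive group V / S comes from ring_quotient; only the scaling has to
   be added. *)
Section QuotientModule.
Variables (A : comNzRingType) (V : lmodType A).
Variables (S : {pred V}) (Sc : submod_closed S).

Local Notation quot := (Quotient.quot (submodule_pred Sc)).

Definition quotient_module : Type := quot.

HB.instance Definition _ := GRing.Zmodule.on quotient_module.

Local Notation proj := (\pi_quot : V -> quotient_module).

Definition quotient_scale (a : A) (x : quotient_module) : quotient_module :=
  proj (a *: repr (x : quot)).

Lemma quotient_scaleE a v : quotient_scale a (proj v) = proj (a *: v).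
Proof.
apply/eqP; rewrite /quotient_scale -Quotient.idealrBE -scalerBr.
by apply: rpredZ; rewrite Quotient.idealrBE reprK.
Qed.

Lemma quotient_scaleA a b x :
  quotient_scale a (quotient_scale b x) = quotient_scale (a * b) x.
Proof.
rewrite -[x](@reprK _ quot).
by rewrite !quotient_scaleE scalerA.
Qed.

Lemma quotient_scale1 : left_id 1 quotient_scale.
Proof.
move=> x; rewrite -[x](@reprK _ quot).
by rewrite quotient_scaleE scale1r.
Qed.

Lemma quotient_scaleDr : right_distributive quotient_scale +%R.
Proof.
move=> a x y; rewrite -[x](@reprK _ quot).
rewrite -[y](@reprK _ quot).
have piD (u v : V) : proj u + proj v = proj (u + v) by rewrite -raddfD.
by rewrite piD !quotient_scaleE scalerDr piD.
Qed.

Lemma quotient_scaleDl x : {morph quotient_scale^~ x : a b / a + b}.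
Proof.
move=> a b; rewrite -[x](@reprK _ quot).
have piD (u v : V) : proj u + proj v = proj (u + v) by rewrite -raddfD.
by rewrite !quotient_scaleE scalerDl piD.
Qed.

HB.instance Definition _ := GRing.Zmodule_isLmodule.Build A quotient_module
  quotient_scaleA quotient_scale1 quotient_scaleDr quotient_scaleDl.

End QuotientModule.

Section ModuleProperties.
Variables (A : comNzRingType) (M : lmodType A).

Definition free_of_rank (n : nat) : Prop :=
  exists f : {linear 'rV[A]_n -> M}, bijective f.

(* N 0 < N 1 < ... < N n; the values of N beyond n are irrelevant. *)
Definition submodule_chain n (N : nat -> {pred M}) : Prop :=
  (forall i, (i <= n)%N -> submod_closed (N i)) /\
  (forall i, (i < n)%N -> strict_subset (N i) (N i.+1)).

Definition finite_length : Prop :=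
  exists l : nat, forall n N, submodule_chain n N -> (n <= l)%N.

(* x belongs to the submodule I M. *)
Definition in_ideal_mul (I : {pred A}) (x : M) : Prop :=
  exists n (a : 'I_n -> A) (v : 'I_n -> M),
    (forall k, a k \in I) /\ x = \sum_k a k *: v k.

End ModuleProperties.

(* Differentials are indexed by arbitrary pairs (i, j) and required to vanish
   unless j = i + 1, so that shifting needs no transport along
   (i + 1) + n = (i + n) + 1. *)
Record complex (A : comNzRingType) := Complex {
  obj :> int -> lmodType A;
  diff : forall i j : int, {linear obj i -> obj j};
  diff_shape : forall i j, j <> i + 1 -> forall x, diff i j x = 0;
  diff_diff : forall i j k x, diff j k (diff i j x) = 0
}.

Section Complexes.
Variable A : comNzRingType.
Implicit Type F : complex A.

Section Cohomology.
Variables (F : complex A) (i : int).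

Definition cocycle : {pred F i} := [pred x | diff F i (i + 1) x == 0].

Lemma cocycle_submod_closed : submod_closed cocycle.
Proof.
split; first by rewrite inE linear0.
by move=> a x y; rewrite !inE linearP => /eqP-> /eqP->; rewrite scaler0 addr0.
Qed.

Definition coboundary : {pred submodule cocycle_submod_closed} :=
  [pred z | `[< exists y : F (i - 1), diff F (i - 1) i y = val z >]].

Lemma coboundary_submod_closed : submod_closed coboundary.
Proof.
split; first by rewrite inE; apply/asboolP; exists 0; rewrite linear0.
move=> a x y; rewrite !inE => /asboolP[u ux] /asboolP[v vy].
by apply/asboolP; exists (a *: u + v); rewrite linearP ux vy.
Qed.

Definition cohomology : lmodType A :=
  quotient_module coboundary_submod_closed.

End Cohomology.

Section Shift.
Variables (F : complex A) (n : int).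

Definition shift_diff (i j : int) : {linear F (i + n) -> F (j + n)} :=
  (-1) ^+ `|n|%N \*: diff F (i + n) (j + n).

Lemma shift_diff_shape i j : j <> i + 1 -> forall x, shift_diff i j x = 0.
Proof.
move=> ij x; rewrite /= diff_shape ?scaler0 // => e.
by apply: ij; apply: (addIr n); rewrite e addrAC.
Qed.

Lemma shift_diff_diff i j k x : shift_diff j k (shift_diff i j x) = 0.
Proof. by rewrite /= linearZ /= diff_diff !scaler0. Qed.

Definition shift : complex A := Complex shift_diff_shape shift_diff_diff.

End Shift.

Definition minimal (m : {pred A}) F : Prop :=
  forall i j (x : F i), in_ideal_mul m (diff F i j x).

Definition finite_length_cohomology F : Prop :=
  forall i, finite_length (cohomology F i).

End Complexes.

(* Main.v *)
(* Let K be the Koszul complex of generators x_1, ..., x_d of m, with the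
   grading forgotten: a free module of rank 2^d with an endomorphism D such that
   D^2 = 0.  Take F^i = K and all differentials equal to D.  Each x_i acts on K
   as S D + D S for some S, so m kills the cohomology, which is finitely
   generated because A is noetherian; hence it has finite length. *)
From HB Require Import structures.
Require Import Defs.
From mathcomp Require Import all_boot all_order all_algebra.
From mathcomp Require Import boolp.

Set Implicit Arguments.
Unset Strict Implicit.
Unset Printing Implicit Defensive.

Import GRing.Theory.
Local Open Scope ring_scope.
Local Open Scope quotient_scope.

(** * Mapping cones of multiplication by a ring element, and homotopies on them *)

Section Cone.
Variables (A : comNzRingType) (M : lmodType A).

(** Mapping cone of multiplication by [x] on [(M, D)], with the grading forgotten. The sign on the
    second component makes the cross terms [D (x *: v)] and [x *: D v] cancel in the square. *)
Definition cone_diff (x : A) (D : {linear M -> M}) (w : M * M) : M * M :=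
  (D w.1 + x *: w.2, - D w.2).

Fact cone_diff_linear x D : linear (cone_diff x D).
Proof.
move=> a [u v] [u' v']; rewrite /cone_diff; apply/pair_equal_spec; split => /=.
  by rewrite linearP !scalerDr !scalerA [x * a]mulrC addrACA.
by rewrite linearP opprD scalerN.
Qed.

HB.instance Definition _ x D :=
  GRing.isLinear.Build A (M * M)%type (M * M)%type _ (cone_diff x D)
    (cone_diff_linear x D).

Definition cone_homotopy (S : {linear M -> M}) (w : M * M) : M * M :=
  (S w.1, - S w.2).

Fact cone_homotopy_linear S : linear (cone_homotopy S).
Proof.
move=> a [u v] [u' v']; rewrite /cone_homotopy; apply/pair_equal_spec.
by split => /=; rewrite linearP // opprD scalerN.
Qed.

HB.instance Definition _ S :=
  GRing.isLinear.Build A (M * M)%type (M * M)%type _ (cone_homotopy S)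
    (cone_homotopy_linear S).

Definition cone_swap (w : M * M) : M * M := (0, w.1).

Fact cone_swap_linear : linear cone_swap.
Proof.
move=> a [u v] [u' v']; apply/pair_equal_spec.
by split => //=; rewrite scaler0 addr0.
Qed.

HB.instance Definition _ :=
  GRing.isLinear.Build A (M * M)%type (M * M)%type _ cone_swap cone_swap_linear.

(** The map contracted here is multiplication by [x], with [D] as the differential; [S] need not
    square to zero. *)
Definition null_homotopic (D : {linear M -> M}) (x : A) : Prop :=
  exists S : {linear M -> M}, forall v, S (D v) + D (S v) = x *: v.

Lemma cone_diffK x (D : {linear M -> M}) :
  (forall v, D (D v) = 0) -> forall w, cone_diff x D (cone_diff x D w) = 0.
Proof.
move=> DD [u v]; apply/pair_equal_spec; split => /=.
  by rewrite linearD linearZ /= DD add0r scalerN subrr.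
by rewrite linearN DD !oppr0.
Qed.

End Cone.

(** The homotopy is [cone_swap]: on [(u, v)] the two composites are [(0, D u + x v)] and
    [(x u, - D u)], with sum [(x u, x v)]. *)
Lemma cone_null_homotopic_last (A : comNzRingType) (M : lmodType A)
    (D : {linear M -> M}) (x : A) :
  null_homotopic (cone_diff x D : {linear _ -> _}) x.
Proof.
exists (@cone_swap A M) => -[u v]; apply/pair_equal_spec; split => /=.
  by rewrite linear0 !add0r.
by rewrite addrAC subrr add0r.
Qed.

(** A homotopy [S] for [y] on [M] extends to the cone as [S] and [- S] on the two summands; the sign
    cancels the cross terms [x *: S v]. *)
Lemma cone_null_homotopic (A : comNzRingType) (M : lmodType A)
    (D : {linear M -> M}) (x y : A) :
  null_homotopic D y -> null_homotopic (cone_diff x D : {linear _ -> _}) y.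
Proof.
case=> S SD; exists (cone_homotopy S) => -[u v].
apply/pair_equal_spec; split => /=.
  by rewrite linearD linearZ /= scalerN addrACA subrr addr0 SD.
by rewrite !linearN !opprK SD.
Qed.

(** * Closure properties of the submodule [I M] *)

Section IdealMul.
Variables (A : comNzRingType) (I : {pred A}).

Lemma in_ideal_mulZ (M : lmodType A) a (v : M) :
  a \in I -> in_ideal_mul I (a *: v).
Proof.
by move=> aI; exists 1, (fun=> a), (fun=> v); split; rewrite ?big_ord1.
Qed.

Lemma in_ideal_mul0 (M : lmodType A) : in_ideal_mul I (0 : M).
Proof.
by exists 0, (fun=> 0), (fun=> 0); split; [case | rewrite big_ord0].
Qed.

Lemma in_ideal_mulD (M : lmodType A) (u v : M) :
  in_ideal_mul I u -> in_ideal_mul I v -> in_ideal_mul I (u + v).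
Proof.
move=> [n [a [f [aI ->]]]] [p [b [g [bI ->]]]].
exists (n + p)%N.
exists (fun k => match split k with inl i => a i | inr j => b j end).
exists (fun k => match split k with inl i => f i | inr j => g j end).
split; first by move=> k; case: split.
rewrite big_split_ord /=; congr (_ + _); apply: eq_bigr => i _.
  by rewrite (unsplitK (inl i)).
by rewrite (unsplitK (inr i)).
Qed.

Lemma in_ideal_mul_linear (M N : lmodType A) (f : {linear M -> N}) v :
  in_ideal_mul I v -> in_ideal_mul I (f v).
Proof.
move=> [n [a [g [aI ->]]]]; exists n, a, (f \o g); split => //.
by rewrite linear_sum; apply: eq_bigr => k _; rewrite linearZ.
Qed.

Lemma in_ideal_mul_pair (M N : lmodType A) (u : M) (v : N) :
  in_ideal_mul I u -> in_ideal_mul I v -> in_ideal_mul I ((u, v) : M * N).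
Proof.
have inl_linear : linear (fun w : M => (w, 0) : M * N).
  by move=> a w w'; apply/pair_equal_spec; split; rewrite //= scaler0 addr0.
have inr_linear : linear (fun w : N => (0, w) : M * N).
  by move=> a w w'; apply/pair_equal_spec; split; rewrite //= scaler0 addr0.
pose il : {linear M -> (M * N)%type} :=
  HB.pack (fun w : M => (w, 0) : M * N) (GRing.isLinear.Build _ _ _ _ _ inl_linear).
pose ir : {linear N -> (M * N)%type} :=
  HB.pack (fun w : N => (0, w) : M * N) (GRing.isLinear.Build _ _ _ _ _ inr_linear).
move=> /(in_ideal_mul_linear il) uI /(in_ideal_mul_linear ir) vI.
have -> : (u, v) = il u + ir v.
  by apply/pair_equal_spec; rewrite /= addr0 add0r.
exact: in_ideal_mulD.
Qed.

End IdealMul.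

(** * Noetherian modules *)

Section Noetherian.
Variable A : comNzRingType.

(** For [M = A^o] this unfolds to [generated_by], and [noetherian_module] to [noetherian], so both
    notions transfer by conversion. *)
Definition spans (M : lmodType A) n (g : 'I_n -> M) (S : {pred M}) : Prop :=
  forall x, x \in S <-> exists c : 'I_n -> A, x = \sum_i c i *: g i.

Definition noetherian_module (M : lmodType A) : Prop :=
  forall S : {pred M}, submod_closed S -> exists n (g : 'I_n -> M), spans g S.

Lemma submod_closed_sum (M : lmodType A) (S : {pred M}) n (c : 'I_n -> A) g :
  submod_closed S -> (forall i, g i \in S) -> \sum_i c i *: g i \in S.
Proof.
move=> [S0 SP] gS; apply: (big_ind (fun v => v \in S)) => // [u v uS vS|i _].
  by rewrite -[u]scale1r; apply: SP.
by rewrite -[_ *: _]addr0; apply: SP.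
Qed.

Lemma spans_mem (M : lmodType A) n (g : 'I_n -> M) (S : {pred M}) i :
  spans g S -> g i \in S.
Proof.
move=> gS; apply/gS; exists (fun j => (j == i)%:R).
rewrite (bigD1 i) //= eqxx scale1r big1 ?addr0 // => j /negPf ->.
by rewrite scale0r.
Qed.

(** A submodule [S] is an extension of its projection [S1] to [M] by its trace [S2] on [N]. Lifts to
    [S] of generators of [S1], together with generators of [S2], generate [S]. *)
Lemma noetherian_module_prod (M N : lmodType A) :
  noetherian_module M -> noetherian_module N -> noetherian_module (M * N)%type.
Proof.
move=> noethM noethN S Sc; have [S0 SP] := Sc.
pose S1 : {pred M} := [pred u | `[< exists v, (u, v) \in S >]].
pose S2 : {pred N} := [pred v | (0, v) \in S].
have [|n1 [g1 gS1]] := noethM S1.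
  split; first by apply/asboolP; exists 0.
  move=> a u u' /asboolP[v uv] /asboolP[v' uv']; apply/asboolP.
  by exists (a *: v + v'); exact: (SP a _ _ uv uv').
have [|n2 [g2 gS2]] := noethN S2.
  split=> // a v v' vS v'S; have := SP a _ _ vS v'S.
  by rewrite /= !inE; congr (_ \in S); apply/pair_equal_spec; rewrite /= scaler0 addr0.
have /choice[h hS] : forall i, exists v, (g1 i, v) \in S.
  by move=> i; apply/asboolP; have := spans_mem i gS1.
pose g k : M * N :=
  match split k with inl i => (g1 i, h i) | inr j => (0, g2 j) end.
have gS i : g i \in S.
  by rewrite /g; case: split => j //; apply: (spans_mem j gS2).
exists (n1 + n2)%N, g => -[u v]; split=> [uvS|[c ->]]; last first.
  exact: submod_closed_sum.
have /gS1[c uE] : u \in S1 by apply/asboolP; exists v.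
pose w := \sum_i c i *: (g1 i, h i).
have w1 : w.1 = u.
  by rewrite uE /w raddf_sum; apply: eq_bigr.
(* Subtracting the combination [w] of lifts kills the first component, so the remainder lies in the
   trace on [N]. *)
have /gS2[e eE] : v - w.2 \in S2.
  rewrite inE; have -> : (0, v - w.2) = -1 *: w + (u, v).
    by apply/pair_equal_spec; rewrite /= w1 !scaleN1r addNr addrC.
  by apply: SP => //; apply: submod_closed_sum.
exists (fun k => match split k with inl i => c i | inr j => e j end).
rewrite big_split_ord /=.
under eq_bigr => i _ do rewrite /g (unsplitK (inl i)).
under [X in _ + X]eq_bigr => i _ do rewrite /g (unsplitK (inr i)).
rewrite -/w; apply/pair_equal_spec; split.
  by rewrite /= w1 raddf_sum big1 ?addr0 // => i _; rewrite /= scaler0.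
by rewrite /= [X in _ + X]raddf_sum -[X in _ + X]eE addrC subrK.
Qed.

End Noetherian.

(** * Free modules of finite rank and the ungraded Koszul complex *)

Section Free.
Variable A : comNzRingType.

Lemma free_of_rank1 : free_of_rank (A^o : lmodType A) 1.
Proof.
pose f (v : 'rV[A]_1) : A^o := v 0 0.
have f_linear : linear f by move=> a u v; rewrite /f !mxE.
pose fL : {linear 'rV[A]_1 -> A^o} :=
  HB.pack f (GRing.isLinear.Build _ _ _ _ f f_linear).
exists fL, (fun a : A^o => const_mx a) => [v|a] /=; last by rewrite /f mxE.
by apply/rowP => i; rewrite !mxE /f ord1.
Qed.

Lemma free_of_rank_prod (M N : lmodType A) n p :
  free_of_rank M n -> free_of_rank N p -> free_of_rank (M * N)%type (n + p).
Proof.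
move=> [f [f' fK f'K]] [g [g' gK g'K]].
pose h (v : 'rV[A]_(n + p)) : M * N := (f (lsubmx v), g (rsubmx v)).
have h_linear : linear h.
  by move=> a u v; apply/pair_equal_spec; split; rewrite !linearP.
pose hL : {linear 'rV[A]_(n + p) -> (M * N)%type} :=
  HB.pack h (GRing.isLinear.Build _ _ _ _ h h_linear).
exists hL, (fun w => row_mx (f' w.1) (g' w.2)) => [v|[u v]].
  by rewrite /h /= fK gK hsubmxK.
by apply/pair_equal_spec; rewrite /= row_mxKl row_mxKr f'K g'K.
Qed.

End Free.

(** Induction on [xs], starting from [A] with zero differential. Each new element [x] replaces [K]
    by the cone of [x]: the rank doubles, entries of the differential stay in [I], old homotopies
    extend and [x] gains one. *)
Lemma koszul_exists (A : comNzRingType) (I : {pred A}) (xs : seq A) :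
  noetherian A -> {subset xs <= I} ->
  exists (K : lmodType A) (D : {linear K -> K}),
    [/\ free_of_rank K (2 ^ size xs), noetherian_module K,
        forall v, D (D v) = 0,
        forall v, in_ideal_mul I (D v)
      & {in xs, forall x, null_homotopic D x}].
Proof.
move=> noethA; elim: xs => [|x xs IH] xsI.
  exists (A^o : lmodType A), (\0 : {linear A^o -> A^o}); split => //.
  - exact: free_of_rank1.
  - by move=> v; exact: in_ideal_mul0.
have [|K [D [Kfree Knoeth DD DI Dxs]]] := IH.
  by move=> y yxs; apply: xsI; rewrite inE yxs orbT.
exists (K * K)%type, (cone_diff x D); split.
- by rewrite expnS mul2n -addnn; exact: free_of_rank_prod.
- exact: noetherian_module_prod.
- exact: cone_diffK.
- move=> [u v]; apply: in_ideal_mul_pair => /=.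
    by apply: in_ideal_mulD => //; apply: in_ideal_mulZ; rewrite xsI ?mem_head.
  by rewrite -linearN.
- move=> y; rewrite inE => /predU1P[->|yxs].
    exact: cone_null_homotopic_last.
  by apply: cone_null_homotopic; exact: Dxs.
Qed.

(** * The periodic complex of a square-zero endomorphism *)

Section PeriodicComplex.
Variables (A : comNzRingType) (M : lmodType A) (D : {linear M -> M}).
Hypothesis DD : forall v, D (D v) = 0.

Definition periodic_diff (i j : int) : {linear M -> M} :=
  if j == i + 1 then D else \0.

Fact periodic_diff_shape i j : j <> i + 1 -> forall x, periodic_diff i j x = 0.
Proof. by rewrite /periodic_diff => /eqP/negPf ->. Qed.

Fact periodic_diff_diff i j k x : periodic_diff j k (periodic_diff i j x) = 0.
Proof.
by rewrite /periodic_diff; do 2 case: ifP => _ //=; rewrite linear0.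
Qed.

Definition periodic_complex : complex A :=
  @Complex A (fun=> M) periodic_diff periodic_diff_shape periodic_diff_diff.

(** The objects form a constant family, so both sides have the same objects by conversion and only
    the differentials have to be compared; the shift sign is [(-1) ^+ 2 = 1]. *)
Lemma periodic_complex_shift : periodic_complex = shift periodic_complex 2.
Proof.
(* Bundled linear maps with the same function differ only in proofs, and likewise complexes with the
   same differentials. *)
have linear_ext (f g : {linear M -> M}) : f =1 g -> f = g.
  case: f g => f [[?] [?]] [g [[?] [?]]] /= /funext fg; subst g.
  by do !f_equal; exact: Prop_irrelevance.
have Complex_ext (d e : int -> int -> {linear M -> M}) d1 d2 e1 e2 :
    d = e -> @Complex A (fun=> M) d d1 d2 = @Complex A (fun=> M) e e1 e2.
  by move=> de; subst e; f_equal; exact: Prop_irrelevance.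
apply: Complex_ext; apply/funext => i; apply/funext => j; apply: linear_ext => v.
rewrite /= sqrrN expr1n scale1r /periodic_diff.
by rewrite [i + 2 + 1]addrAC (inj_eq (addIr _)).
Qed.

End PeriodicComplex.

(** * Finite length of finitely generated modules killed by a maximal ideal *)

Lemma inverse_mod_maximal (A : comNzRingType) (m : {pred A}) (a : A) :
  maximal_ideal m -> a \notin m -> exists b, 1 - b * a \in m.
Proof.
move=> [[m0 m1 mP] mmax] am; apply: contrapT => noinv.
(* [J] is the ideal [m + A a]. Without an inverse of [a] modulo [m] it omits 1, so maximality gives
   [J = m], although [a] lies in [J]. *)
pose J : {pred A} := [pred x | `[< exists b, x - b * a \in m >]].
have aJ : a \in J by apply/asboolP; exists 1; rewrite mul1r subrr.
have : J =i m.
  apply: mmax => [|x xm]; last by apply/asboolP; exists 0; rewrite mul0r subr0.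
  split; first by apply/asboolP; exists 0; rewrite mul0r subr0.
    by apply/negP => /asboolP.
  move=> c x y /asboolP[b xb] /asboolP[e ye]; apply/asboolP.
  exists (c * b + e); have := mP c _ _ xb ye.
  by rewrite mulrDl mulrBr mulrA opprD addrACA.
by move=> Jm; rewrite -Jm aJ in am.
Qed.

Section FiniteLength.
Variables (A : comNzRingType) (m : {pred A}) (V : lmodType A).
Hypotheses (mmax : maximal_ideal m).
Hypothesis mV : forall a (v : V), a \in m -> a *: v = 0.

(* Steinitz exchange: an element of N 1 outside N 0 has a coefficient invertible
   modulo m, so one generator becomes redundant modulo N 1. *)
Lemma submodule_chain_length l (g : 'I_l -> V) n (N : nat -> {pred V})
    (P : {set 'I_l}) :
  submodule_chain n N ->
  (forall v, exists c : 'I_l -> A, v - \sum_(i in P) c i *: g i \in N 0%N) ->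
  (n <= #|P|)%N.
Proof.
elim: n N P => [//|n IH] N P [Nc Ns] Pgen.
have [N01 [v vN1 vN0]] := Ns 0%N isT.
have [N00 N0P] := Nc 0%N isT; have [N10 N1P] := Nc 1%N isT.
have [c vc] := Pgen v.
have [j jP cj] : exists2 j, j \in P & c j \notin m.
  (* If every [c i] were in [m], the sum would vanish because [m] kills [V], and [v] would lie in
     [N 0]. *)
  apply: contrapT => noj; move/negP: vN0; apply.
  move: vc; rewrite big1 ?subr0 // => i iP; apply: mV.
  by apply: contrapT => /negP cim; apply: noj; exists i.
have [b bm] := inverse_mod_maximal mmax cj.
rewrite (cardsD1 j) jP add1n ltnS.
apply: (IH (N \o succn)) => [|w]; first by split=> i ?; [apply: Nc | apply: Ns].
have [e we] := Pgen w.
(* Since [b * c j] acts as 1, the relation for [v] gives [g j] as minus the sum of the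
   [(b * c i) *: g i] over the other [i], modulo [N 1]. Substituting this for [g j] in the expansion
   of [w] yields these coefficients. *)
exists (fun i => e i - e j * b * c i).
have bcg : g j = b *: (c j *: g j).
  by apply/eqP; rewrite -subr_eq0 scalerA -[X in X - _]scale1r -scalerBl mV.
rewrite /=.
have -> : w - \sum_(i in P :\ j) (e i - e j * b * c i) *: g i =
    (e j * b) *: v + (- (e j * b) *: (v - \sum_(i in P) c i *: g i)
      + (w - \sum_(i in P) e i *: g i)).
  rewrite !(big_setD1 j jP) /=.
  under eq_bigr => i _ do rewrite scalerBl -[(_ * c i) *: _]scalerA.
  rewrite sumrB -scaler_sumr.
  set X := \sum_(i in _) e i *: _; set Y := \sum_(i in _) c i *: _.
  rewrite !scaleNr scalerBr scalerDr -[(e j * b) *: (c j *: _)]scalerA -bcg.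
  rewrite -/X -/Y !opprB [RHS]addrA [_ + (_ - (e j * b) *: v)]addrC subrK.
  by rewrite [RHS]addrC opprD -!addrA [- X + (_ + _)]addrCA addKr [- X + _]addrC.
by apply: (N1P) => //; apply: N01; apply: N0P.
Qed.

Lemma finite_length_of_spans l (g : 'I_l -> V) :
  (forall v, exists c : 'I_l -> A, v = \sum_i c i *: g i) -> finite_length V.
Proof.
move=> gV; exists l => n N chainN.
rewrite -[l]card_ord -cardsT.
apply: (submodule_chain_length (g := g) chainN) => v.
have [c ->] := gV v; exists c.
under [X in _ - X]eq_bigl => i do rewrite inE.
by rewrite subrr; case: chainN => /(_ 0%N isT)[].
Qed.

End FiniteLength.

(** On a cocycle [z] the homotopy gives [x k *: z = D (S z)], a coboundary, so [m] kills the
    cohomology. The cocycles are finitely generated, being a submodule of the noetherian [M], and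
    their classes span. *)
Lemma periodic_cohomology_finite_length (A : comNzRingType) (m : {pred A})
    (M : lmodType A) (D : {linear M -> M}) (DD : forall v, D (D v) = 0)
    n (x : 'I_n -> A) :
  maximal_ideal m -> noetherian_module M -> generated_by x m ->
  (forall i, null_homotopic D (x i)) ->
  finite_length_cohomology (periodic_complex DD).
Proof.
move=> mmax Mnoeth xm Dx i.
set F := periodic_complex DD.
pose Z := submodule (@cocycle_submod_closed A F i).
pose proj : Z -> cohomology F i := \pi_(Quotient.quot _).
have projD y z : proj (y + z) = proj y + proj z by rewrite /proj raddfD.
have projZ a z : a *: proj z = proj (a *: z) by exact: quotient_scaleE.
have projK h : exists z, proj z = h by exists (repr h); exact: reprK.
have [p [g gZ]] := Mnoeth _ (@cocycle_submod_closed A F i).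
have gcocycle k : g k \in submodule_pred (@cocycle_submod_closed A F i).
  exact: (spans_mem k gZ).
pose gz k : Z := Submodule (gcocycle k).
have proj0 : proj 0 = 0 by rewrite -(scale0r (0 : Z)) -projZ scale0r.
have xproj k z : x k *: proj z = 0.
  rewrite projZ -proj0; apply/eqP; rewrite -Quotient.idealrBE subr0.
  have [S SD] := Dx k; apply/asboolP; exists (S (val z)).
  have /eqP Dz : diff F i (i + 1) (val z) == 0 by exact: (valP z).
  (* Here [subrK] turns [i - 1 + 1] into [i], so the incoming differential is [D] as well. *)
  move: Dz; rewrite /= /periodic_diff subrK !eqxx => Dz.
  by rewrite /= -SD Dz linear0 add0r.
apply: (finite_length_of_spans mmax _ (g := fun k => proj (gz k))) => [a h am|h].
  have [z <-] := projK h; have /xm[c ->] := am.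
  by rewrite scaler_suml big1 // => k _; rewrite -scalerA xproj scaler0.
have [z <-] := projK h.
have /gZ[c zE] : (val z : F i) \in @cocycle A F i by exact: (valP z).
exists c.
have -> : z = \sum_k c k *: gz k.
  by apply: val_inj; rewrite zE raddf_sum.
by rewrite (big_morph proj projD proj0); apply: eq_bigr => k _; rewrite projZ.
Qed.

Theorem theorem7p14 (A : comNzRingType) (m : {pred A}) (d : nat)
    (hd : (1 <= d)%N) (hA : regular_local_ring m d) :
  exists F : complex A,
    [/\ F = shift F 2,
        minimal m F,
        finite_length_cohomology F
      & forall i : int, free_of_rank (F i) (2 ^ d)].
Proof.
(* Regularity supplies a generating family [x] of [m] with exactly [d] members; the length of
   [codom x] is the exponent in the rank. *)
have [noethA [mmax _] _ [[x xm] _]] := hA.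
have xI : {subset codom x <= m}.
  by move=> _ /codomP[i ->]; exact: (spans_mem (M := A^o) i xm).
have [K [D [Kfree Knoeth DD DI Dx]]] := koszul_exists noethA xI.
exists (periodic_complex DD); split.
- exact: periodic_complex_shift.
- move=> i j v /=; rewrite /periodic_diff; case: ifP => _; first exact: DI.
  exact: in_ideal_mul0.
- apply: (periodic_cohomology_finite_length DD mmax Knoeth xm) => i.
  by apply: Dx; exact: codom_f.
- by move=> i; move: Kfree; rewrite size_codom card_ord.
Qed.
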